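(* Let $c(n)$, for integers $n\geq -1$, be defined by the $q$-expansion $$\frac{\eta^{24}(\tau)}{\eta^{24}(2\tau)}=\frac{1}{q}\prod_{m=1}^{\infty}\frac{(1-q^{m})^{24}}{(1-q^{2m})^{24}}=\sum_{n=-1}^{\infty}c(n)q^{n},$$ where $q=e^{2\pi i\tau}$, $\tau$ in the upper half-plane. Then for every integer $n\geq -1$ we have $(-1)^{n+1}c(n)>0$; that is, $c(n)>0$ if $n$ is odd and $c(n)<0$ if $n$ is even.
   Context: $\eta(\tau)=q^{1/24}\prod_{m=1}^{\infty}(1-q^{m})$ is the Dedekind eta function, with $q=e^{2\pi i\tau}$ and $\operatorname{Im}\tau>0$. *)

(* Defs.v *)
From HB Require Import structures.
From mathcomp Require Import all_boot all_order all_algebra.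
From mathcomp Require Import complex.
From mathcomp Require Import all_classical all_reals all_analysis.

Set Implicit Arguments.
Unset Strict Implicit.
Unset Printing Implicit Defensive.

Import Order.TTheory GRing.Theory Num.Theory.
Import numFieldNormedType.Exports.

Local Open Scope classical_set_scope.
Local Open Scope ring_scope.
Local Open Scope complex_scope.

(* exp (x + i y) = e^x (cos y + i sin y) *)
Definition cexp (R : realType) (z : R[i]) : R[i] :=
  (expR (complex.Re z))%:C *
  (cos (complex.Im z) +i* sin (complex.Im z)).

Definition qexp (R : realType) (tau : R[i]) : R[i] := cexp (2%:R * pi%:C * 'i%C * tau).

(* [R[i]^o] carries the topology of the modulus; [q^(1/24)] is, as usual,
   [exp (2 pi i tau / 24)]. Outside [Im tau > 0] the value is irrelevant. *)
Definition eta (R : realType) (tau : R[i]) : R[i] :=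
  cexp (2%:R * pi%:C * 'i%C * tau / 24%:R) *
  limn (fun N : nat => (\prod_(1 <= m < N.+1) (1 - qexp tau ^+ m)) : R[i]^o).

(* [k]-th term, [k = 0, 1, ...], is the one of index [n = k - 1]. *)
Definition has_q_expansion (R : realType) (f : R[i] -> R[i]) (c : int -> R[i]) :
    Prop :=
  forall tau : R[i], 0 < complex.Im tau ->
    series (fun k : nat => c (k%:Z - 1) * qexp tau ^ (k%:Z - 1) : R[i]^o) @ \oo
      --> (f tau : R[i]^o).

(* Main.v *)
(** Since prod (1 - q^m) / prod (1 - q^(2m)) = prod (1 - q^(2m-1)), at q = -x
    the quotient is - x^-1 prod (1 + x^(2m-1))^24, a product whose partial
    products are polynomials with nonnegative coefficients: the k-th coefficient
    increases with the number of factors and is eventually constant, so the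
    power series of the limit is obtained by monotone convergence. Its k-th
    coefficient counts partitions of k into odd parts in 24 colours, each
    coloured part used at most once, hence is positive. Points tau on the line
    Re tau = 1/2 give every small q = -x < 0, which is enough for uniqueness of
    power series coefficients to identify this coefficient with (-1)^k c(k-1). *)
Require Import Defs.
From mathcomp Require Import all_boot all_order all_algebra.
From mathcomp Require Import complex.
From mathcomp Require Import all_classical all_reals all_analysis.
From mathcomp Require Import zify ring lra.
Import Order.TTheory GRing.Theory Num.Theory.
Import numFieldNormedType.Exports.
Local Open Scope ring_scope.
Local Open Scope complex_scope.

Set Implicit Arguments.
Unset Strict Implicit.
Unset Printing Implicit Defensive.

(** * Coefficients of the product of the [(1 + X^(2m+1))^24] *)

Definition odd_prod24 (R : realType) (N : nat) : {poly R} :=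
  \prod_(m < N) (1 + 'X^(m.*2.+1)) ^+ 24.

(** [k] factors settle degree [k], since each later factor is congruent to 1 modulo [X^(2k+1)]. *)
Definition odd_coef24 (R : realType) (k : nat) : R := (odd_prod24 R k)`_k.

Lemma odd_prod24_polyOver (R : realType) (N : nat) :
  odd_prod24 R N \is a polyOver (@Num.Def.nneg_num_pred R).
Proof.
apply: rpred_prod => m _; apply: rpredX.
by rewrite rpredD ?rpred1 ?rpredX ?polyOverX.
Qed.

(** For [y = 1 + X^n], expand [y^24 - 1 = (y - 1) * (1 + y + ... + y^23)]. The leading 1 of the sum
    stays outside [Q] because strict positivity of the coefficients rests on it. *)
Lemma expr1D24 (R : realType) (n : nat) :
  exists2 Q : {poly R}, Q \is a polyOver (@Num.Def.nneg_num_pred R) &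
    (1 + 'X^n) ^+ 24 = 1 + 'X^n * (1 + Q).
Proof.
exists (\sum_(i < 23) (1 + 'X^n) ^+ i.+1).
  apply: rpred_sum => i _; apply: rpredX.
  by rewrite rpredD ?rpred1 ?rpredX ?polyOverX.
rewrite -[LHS](subrK 1) subrX1 big_ord_recl expr0.
under eq_bigr => i _ do rewrite lift0.
ring.
Qed.

(** This recurrence yields stability (low degrees are unchanged), monotonicity (the increment is
    nonnegative) and positivity (the increment contains an earlier coefficient). *)
Lemma odd_prod24_coefS (R : realType) (N : nat) :
  exists2 Q : {poly R}, Q \is a polyOver (@Num.Def.nneg_num_pred R) &
    forall k, (odd_prod24 R N.+1)`_k = (odd_prod24 R N)`_k +
      if (k < N.*2.+1)%N then 0
      else (odd_prod24 R N)`_(k - N.*2.+1) + Q`_(k - N.*2.+1).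
Proof.
have [Q Qge0 E] := expr1D24 R N.*2.+1.
exists (odd_prod24 R N * Q); first by rewrite rpredM ?odd_prod24_polyOver.
move=> k; rewrite {1}/odd_prod24 big_ord_recr /= -/(odd_prod24 R N) E mulrDr.
by rewrite mulr1 mulrCA mulrDr mulr1 coefD coefXnM coefD.
Qed.

Lemma odd_prod24_coef_ge0 (R : realType) (N k : nat) : 0 <= (odd_prod24 R N)`_k.
Proof. by have /polyOverP/(_ k) := odd_prod24_polyOver R N. Qed.

Lemma odd_prod24_coef_stable (R : realType) (N k : nat) :
  (k <= N)%N -> (odd_prod24 R N)`_k = odd_coef24 R k.
Proof.
elim: N => [|N IH]; first by rewrite leqn0 => /eqP ->.
rewrite leq_eqVlt => /predU1P[-> //|]; rewrite ltnS => kN.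
have [Q _ ->] := odd_prod24_coefS R N.
by rewrite ifT ?addr0 ?IH // ltnS -addnn (leq_trans kN) ?leq_addr.
Qed.

Lemma odd_prod24_coef_homo (R : realType) (k : nat) :
  {homo (fun N => (odd_prod24 R N)`_k) : N M / (N <= M)%N >-> N <= M}.
Proof.
apply/nondecreasing_seqP => N; have [Q /polyOverP Qge0 ->] := odd_prod24_coefS R N.
rewrite lerDl; case: ifP => // _.
by rewrite addr_ge0 ?odd_prod24_coef_ge0 //; exact: Qge0.
Qed.

Lemma odd_prod24_coef_le (R : realType) (N k : nat) :
  (odd_prod24 R N)`_k <= odd_coef24 R k.
Proof.
have [kN|Nk] := leqP k N; first by rewrite odd_prod24_coef_stable.
exact/odd_prod24_coef_homo/ltnW.
Qed.

(** In the induction step the new exponent is [2N+3] and the new degrees are [2N+3] and [2N+4];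
    shifted down by [2N+3] they become 0 and 1, already covered. *)
Lemma odd_prod24_coef_gt0 (R : realType) (N k : nat) :
  (k <= N.+1.*2)%N -> 0 < (odd_prod24 R N.+1)`_k.
Proof.
elim: N k => [|N IH] k kN.
  rewrite /odd_prod24 big_ord1 /= exprDn coef_sum.
  have k25 : (k < 25)%N by exact: leq_trans kN _.
  rewrite (bigD1 (Ordinal k25)) //=; apply: ltr_pwDl; last apply: sumr_ge0.
    by rewrite expr1n mul1r expr1 coefMn coefXn eqxx ltr0n bin_gt0.
  by move=> i _; rewrite expr1n mul1r expr1 coefMn coefXn; exact: mulrn_wge0.
have [Q /polyOverP Qge0 ->] := odd_prod24_coefS R N.+1.
case: ltnP => h; first by rewrite addr0 IH //; lia.
rewrite ltr_wpDl ?odd_prod24_coef_ge0 // ltr_pwDl ?IH //; first lia.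
exact: Qge0.
Qed.

Lemma odd_coef24_gt0 (R : realType) (k : nat) : 0 < odd_coef24 R k.
Proof.
(* Degree 0 is separate because [odd_coef24] then reads the empty product. *)
case: k => [|k]; last by apply: odd_prod24_coef_gt0; lia.
by rewrite /odd_coef24 /odd_prod24 big_ord0 coef1.
Qed.

Lemma odd_prod24_horner (R : realType) (N : nat) (x : R) :
  (odd_prod24 R N).[x] = (\prod_(m < N) (1 + x ^+ m.*2.+1)) ^+ 24.
Proof.
rewrite /odd_prod24 horner_prod -prodrXl; apply: eq_bigr => m _.
by rewrite horner_exp !hornerE.
Qed.

(** Partial sums and partial products dominate each other: [S n] uses only stabilised coefficients
    of the [n]-th product ([SP]), and each product is a polynomial with coefficients below the
    limiting ones ([PS]). Two such monotone sequences have the same limit. *)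
Lemma odd_coef24_series (R : realType) (x G : R) : 0 <= x ->
  ((fun N => \prod_(m < N) (1 + x ^+ m.*2.+1)) @ \oo --> G)%classic ->
  (series (fun k => odd_coef24 R k * x ^+ k) @ \oo --> G ^+ 24)%classic.
Proof.
move=> x0 cvgG; set S := series _.
have SH : {homo S : n m / (n <= m)%N >-> n <= m}.
  apply/nondecreasing_seqP => n; rewrite /S !seriesEord /= big_ord_recr /=.
  by rewrite lerDl mulr_ge0 ?exprn_ge0 // ltW ?odd_coef24_gt0.
have cvgP : ((fun N => (odd_prod24 R N).[x]) @ \oo --> G ^+ 24)%classic.
  under eq_fun do rewrite odd_prod24_horner.
  exact: (continuous_cvg _ (@exprn_continuous _ 24 G) cvgG).
have PH : {homo (fun N => (odd_prod24 R N).[x]) : n m / (n <= m)%N >-> n <= m}.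
  apply/nondecreasing_seqP => n; rewrite !odd_prod24_horner.
  rewrite lerXn2r ?nnegrE ?prodr_ge0 //; try by move=> *; rewrite addr_ge0 ?exprn_ge0.
  rewrite big_ord_recr /= ler_peMr ?lerDl ?exprn_ge0 //.
  by rewrite prodr_ge0 // => *; rewrite addr_ge0 ?exprn_ge0.
have PG N : (odd_prod24 R N).[x] <= G ^+ 24.
  rewrite -(cvg_lim _ cvgP) //; apply: nondecreasing_cvgn_le PH _ N.
  by apply/cvg_ex; exists (G ^+ 24).
have SP n : S n <= (odd_prod24 R n).[x].
  (* The size of the polynomial and [n] are not compared; both sums are padded to their maximum. *)
  rewrite (horner_coef_wide _ (leq_maxl (size (odd_prod24 R n)) n)).
  rewrite /S seriesEord /=.
  rewrite (big_ord_widen _ (fun k => odd_coef24 R k * x ^+ k)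
    (leq_maxr (size (odd_prod24 R n)) n)).
  rewrite big_mkcond; apply: ler_sum => i _; case: ifP => [lt_in|_].
    by rewrite odd_prod24_coef_stable // ltnW.
  by rewrite mulr_ge0 ?exprn_ge0 ?odd_prod24_coef_ge0.
have PS N : (odd_prod24 R N).[x] <= S (size (odd_prod24 R N)).
  rewrite horner_coef /S seriesEord /=; apply: ler_sum => i _.
  by rewrite ler_wpM2r ?exprn_ge0 ?odd_prod24_coef_le.
have Scvg : cvgn S.
  apply: nondecreasing_is_cvgn => //; exists (G ^+ 24) => _ [n _ <-].
  exact: le_trans (SP n) (PG n).
suff -> : G ^+ 24 = limn S by [].
apply/eqP; rewrite eq_le; apply/andP; split.
  rewrite -(cvg_lim _ cvgP) //; apply: limr_le.
    by apply/cvg_ex; exists (G ^+ 24).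
  near=> N; apply: le_trans (PS N) _; exact: nondecreasing_cvgn_le.
apply: limr_le => //; near=> n; exact: le_trans (SP n) (PG n).
Unshelve. all: by end_near. Qed.
(** * Convergence of infinite products *)

Lemma prod1B_ge (R : realType) (y : nat -> R) (N : nat) :
  (forall m, 0 <= y m <= 1) ->
  1 - \sum_(m < N) y m <= \prod_(m < N) (1 - y m).
Proof.
move=> y01; elim: N => [|N IH]; first by rewrite !big_ord0 subr0.
rewrite !big_ord_recr /=; have /andP[y0 y1] := y01 N.
have S0 : 0 <= \sum_(m < N) y m by apply: sumr_ge0 => m _; case/andP: (y01 m).
apply: le_trans (ler_wpM2r _ IH); [nra | lra].
Qed.

(** Division-free Weierstrass inequality, from [(1 + y) * (1 - S - y) <= 1 - S] for nonnegative [y]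
    and [S]. *)
Lemma prod1D_le (R : realType) (y : nat -> R) (N : nat) : (forall m, 0 <= y m) ->
  (\prod_(m < N) (1 + y m)) * (1 - \sum_(m < N) y m) <= 1.
Proof.
move=> y0; elim: N => [|N IH]; first by rewrite !big_ord0 subr0 mulr1.
rewrite !big_ord_recr /=; have yN := y0 N.
have S0 : 0 <= \sum_(m < N) y m by apply: sumr_ge0.
have P0 : 0 <= \prod_(m < N) (1 + y m) by apply: prodr_ge0 => m _; rewrite addr_ge0.
apply: le_trans IH; rewrite -mulrA; apply: ler_wpM2l => //; nra.
Qed.

(** The products decrease and stay at least 1/2. Positivity of the limit is recorded so that it can
    be cancelled from the eta quotient. *)
Lemma cvg_prod1B (R : realType) (y : nat -> R) : (forall m, 0 <= y m) ->
  (forall N, \sum_(m < N) y m <= 2^-1) ->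
  exists2 L : R, 0 < L & ((fun N => \prod_(m < N) (1 - y m)) @ \oo --> L)%classic.
Proof.
move=> y0 hS.
have y1 m : 0 <= y m <= 1.
  have := hS m.+1; rewrite big_ord_recr /=.
  have : 0 <= \sum_(i < m) y i by apply: sumr_ge0.
  by rewrite y0 /=; lra.
have P2 N : 2^-1 <= \prod_(m < N) (1 - y m).
  by apply: le_trans (prod1B_ge _ y1); have := hS N; lra.
have cP : cvgn (fun N => \prod_(m < N) (1 - y m)).
  apply: nonincreasing_is_cvgn; last by exists 2^-1 => _ [n _ <-].
  apply/nonincreasing_seqP => N; rewrite big_ord_recr /= ler_piMr //.
    by apply: le_trans (P2 N); lra.
  by rewrite gerBl.
exists (limn (fun N => \prod_(m < N) (1 - y m))) => //.
apply: lt_le_trans (limr_ge cP _); last by near=> N; exact: (P2 N).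
by rewrite invr_gt0.
Unshelve. all: by end_near. Qed.

Lemma cvg_prod1D (R : realType) (y : nat -> R) : (forall m, 0 <= y m) ->
  (forall N, \sum_(m < N) y m <= 2^-1) ->
  exists L : R, ((fun N => \prod_(m < N) (1 + y m)) @ \oo --> L)%classic.
Proof.
move=> y0 hS; apply/cvg_ex.
have P0 N : 0 <= \prod_(m < N) (1 + y m).
  by apply: prodr_ge0 => m _; rewrite addr_ge0.
apply: nondecreasing_is_cvgn; last first.
  (* The bound is [1 / (1 - 1/2)], from [prod1D_le]. *)
  exists 2 => _ [n _ <-].
  have := @prod1D_le _ _ n y0; have := P0 n; have := hS n.
  by set P := \prod_(_ < _) _; set S := \sum_(_ < _) _; nra.
apply/nondecreasing_seqP => N; rewrite big_ord_recr /=.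
by apply: ler_peMr; [exact: P0 | rewrite lerDl].
Qed.

(** Source of the radius 1/3: it is where [x / (1 - x)] reaches 1/2. *)
Lemma sum_expr_le (R : realType) (x : R) (f : nat -> nat) (N : nat) :
  0 <= x <= 3^-1 -> (forall m, (m < f m)%N) -> \sum_(m < N) x ^+ f m <= 2^-1.
Proof.
move=> /andP[x0 x3] hf.
have h : \sum_(m < N) x ^+ f m <= \sum_(m < N) x ^+ m.+1.
  by apply: ler_sum => m _; apply: ler_wiXn2l => //; lra.
apply: le_trans h _.
suff : \sum_(m < N) x ^+ m.+1 <= 2^-1 * (1 - x ^+ N).
  by have := exprn_ge0 N x0; lra.
elim: N => [|N IH]; first by rewrite big_ord0 expr0 subrr mulr0.
rewrite big_ord_recr /= exprS; have := exprn_ge0 N x0; nra.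
Qed.

Lemma cvg_half : (half @ \oo --> \oo)%classic.
Proof.
move=> A [n _ nA]; exists n.*2 => // m /= nm; apply: nA => /=.
by rewrite -(doubleK n) half_leq.
Qed.

Lemma cvg_uphalf : (uphalf @ \oo --> \oo)%classic.
Proof.
move=> A [n _ nA]; exists n.*2 => // m /= nm; apply: nA => /=.
by rewrite geq_uphalf_double leqW.
Qed.

(** Odd [m] turn the sign into a plus, even [m] keep the minus; [uphalf N] and [N./2] count them in
    [1..N]. *)
Lemma prod_1BN_split (R : comNzRingType) (x : R) (N : nat) :
  \prod_(1 <= m < N.+1) (1 - (- x) ^+ m) =
  (\prod_(m < uphalf N) (1 + x ^+ m.*2.+1)) *
  \prod_(m < N./2) (1 - x ^+ m.*2.+2).
Proof.
elim: N => [|N IH]; first by rewrite big_geq // !big_ord0 mulr1.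
rewrite big_nat_recr //= IH exprNn -signr_odd /=.
have := odd_double_half N; move: (N./2) => n.
case: (odd N) => /= <-; rewrite ?add0n ?add1n /=.
  by rewrite expr0 mul1r doubleK [X in _ = _ * X]big_ord_recr /= mulrA.
by rewrite expr1 mulN1r opprK !uphalf_double [X in _ = X * _]big_ord_recr /= mulrAC.
Qed.

(** [D] is both the even-exponent part of the Euler product at [-x] and the whole Euler product at
    [x^2], so it cancels in the quotient. *)
Lemma cvg_euler_split (R : realType) (x : R) : 0 <= x <= 3^-1 ->
  exists G D : R, [/\ 0 < D,
    ((fun N => \prod_(m < N) (1 + x ^+ m.*2.+1)) @ \oo --> G)%classic,
    ((fun N => \prod_(1 <= m < N.+1) (1 - (x ^+ 2) ^+ m)) @ \oo --> D)%classic &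
    ((fun N => \prod_(1 <= m < N.+1) (1 - (- x) ^+ m)) @ \oo --> G * D)%classic].
Proof.
move=> x03; have /andP[x0 _] := x03.
have [G hG] : exists G : R,
    ((fun N => \prod_(m < N) (1 + x ^+ m.*2.+1)) @ \oo --> G)%classic.
  apply: (@cvg_prod1D R (fun m => x ^+ m.*2.+1)) => [m|N]; first exact: exprn_ge0.
  by apply: (@sum_expr_le R x (fun m => m.*2.+1)) => // m; lia.
have [D D0 hD] : exists2 D : R, 0 < D &
    ((fun N => \prod_(m < N) (1 - x ^+ m.*2.+2)) @ \oo --> D)%classic.
  apply: (@cvg_prod1B R (fun m => x ^+ m.*2.+2)) => [m|N]; first exact: exprn_ge0.
  by apply: (@sum_expr_le R x (fun m => m.*2.+2)) => // m; lia.
exists G, D; split => //.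
  suff -> : (fun N => \prod_(1 <= m < N.+1) (1 - (x ^+ 2) ^+ m)) =
            (fun N => \prod_(m < N) (1 - x ^+ m.*2.+2)) by [].
  apply/funext => N; rewrite big_add1 /= big_mkord; apply: eq_bigr => m _.
  by rewrite -exprM mul2n.
under eq_fun do rewrite prod_1BN_split.
apply: cvgM; first exact: (cvg_comp _ _ cvg_uphalf hG).
exact: (cvg_comp _ _ cvg_half hD).
Qed.

(** * Uniqueness of power series coefficients *)

Lemma sum_geo_tail_le (R : realType) (y : R) (k n : nat) : 0 <= y <= 2^-1 ->
  \sum_(k <= j < n) y ^+ j <= 2 * y ^+ k.
Proof.
move=> /andP[y0 y2]; have [nk|kn] := leqP n k.
  by rewrite big_geq // mulr_ge0 ?exprn_ge0.
suff : \sum_(k <= j < n) y ^+ j <= 2 * y ^+ k - 2 * y ^+ n.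
  by have := exprn_ge0 n y0; lra.
elim: n kn => // n IH; rewrite ltnS leq_eqVlt => /predU1P[->|kn].
  by rewrite big_nat1 exprS; have := exprn_ge0 n y0; nra.
rewrite big_nat_recr ?(ltnW kn) //= exprS.
by have := IH kn; have := exprn_ge0 n y0; nra.
Qed.

(** Once the coefficients below [k] vanish, the term of index [k] at [x = r * y] is balanced by a
    tail of size at most [2 * M * y^(k+1)]. Dividing by [y^k] and letting [y] tend to 0 gives
    [d k = 0]. *)
Lemma power_series_eq0 (R : realType) (r : R) (d : nat -> R) : 0 < r ->
  (forall x, 0 < x <= r -> (series (fun k => d k * x ^+ k) @ \oo --> (0 : R))%classic) ->
  forall k, d k = 0.
Proof.
move=> r0 hd.
have [M M0 hM] : exists2 M, 0 < M & forall j, `|d j * r ^+ j| <= M.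
  have cr := hd r; rewrite r0 lexx in cr.
  have /cvg_series_cvg_0 c0 : cvgn (series (fun k => d k * r ^+ k)).
    by apply/cvg_ex; exists 0; exact: cr.
  have /cvg_seq_bounded : cvgn (fun k => d k * r ^+ k) by apply/cvg_ex; exists 0.
  move=> /pinfty_ex_gt0[M M0 hM]; exists M => // j; exact: hM.
elim/ltn_ind => k IH.
have key y : 0 < y <= 2^-1 -> `|d k| * r ^+ k <= 2 * M * y.
  move=> /andP[y0 y2]; have x0 : 0 < r * y by rewrite mulr_gt0.
  have xr : r * y <= r by rewrite ler_piMr //; lra.
  have := hd (r * y); rewrite x0 xr => /(_ isT) c0.
  have yk : 0 < y ^+ k by rewrite exprn_gt0.
  rewrite -(ler_pM2r yk) -!mulrA -exprMn -(ger0_norm (exprn_ge0 k (ltW x0))) -normrM.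
  rewrite mulrCA [leRHS]mulrCA -exprS.
  apply/ler_addgt0Pr => e e0.
  have /cvgrPdist_lt/(_ e e0)[n0 _ hn0] := c0.
  (* This index lies past [n0], for closeness to the limit, and past [k], so that the term of index
     [k] is in the sum. *)
  have /= := hn0 (n0 + k.+1)%N (leq_addr _ _); rewrite sub0r normrN.
  set n := (n0 + k.+1)%N; rewrite seriesEnat /=.
  have kn : (k < n)%N by rewrite /n addnS ltnS leq_addl.
  rewrite (big_cat_nat (leq0n k) (ltnW kn)) /= big1_seq ?add0r; last first.
    by move=> j; rewrite mem_index_iota => /andP[_ /andP[_ jk]]; rewrite IH // mul0r.
  rewrite big_ltn //; set T := \sum_(_ <= _ < _) _ => hT.
  have TM : `|T| <= M * (2 * y ^+ k.+1).
    apply: le_trans (ler_norm_sum _ _ _) _.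
    apply: le_trans (_ : \sum_(k.+1 <= j < n) M * y ^+ j <= _).
      apply: ler_sum => j _; rewrite exprMn mulrA normrM.
      by rewrite (ger0_norm (exprn_ge0 j (ltW y0))) ler_wpM2r // exprn_ge0 // ltW.
    rewrite -mulr_sumr ler_pM2l // sum_geo_tail_le //; lra.
  have := ler_normB (d k * (r * y) ^+ k + T) T; rewrite addrK; lra.
apply/eqP; rewrite -normr_le0 -(pmulr_lle0 _ (exprn_gt0 k r0)).
apply/ler_addgt0Pr => e e0; rewrite add0r.
(* The second entry makes [2 * M * y] at most [e]; the first keeps [y] in the range of [key]. *)
have h := key (Num.min 2^-1 (e / (2 * M))).
apply: le_trans (h _) _.
  by rewrite lt_min ge_min lexx invr_gt0 ltr0n divr_gt0 // mulr_gt0.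
have M2 : 0 < 2 * M by rewrite mulr_gt0.
by rewrite mulrC -ler_pdivlMr // ge_min lexx orbT.
Qed.

(** * Complex limits and the eta quotient at [q = -x] *)

Lemma normc_ge_Im (R : realType) (z : R[i]) : `|complex.Im z|%:C <= `|z|.
Proof. by rewrite normc_def lecR -sqrtr_sqr ler_wsqrtr // lerDr sqr_ge0. Qed.

Lemma cvg_complex_parts (R : realType) (u : nat -> R[i]) (l : R[i]) :
  ((u : nat -> R[i]^o) @ \oo --> (l : R[i]^o))%classic ->
  ((fun n => complex.Re (u n)) @ \oo --> complex.Re l)%classic /\
  ((fun n => complex.Im (u n)) @ \oo --> complex.Im l)%classic.
Proof.
move=> /cvgrPdist_lt ul; split; apply/cvgrPdist_lt => e e0.
  have /(_ _)/[dup] := ul e%:C; rewrite ltcR => /(_ e0)[n _ hn] _.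
  exists n => // m /hn /= hm; rewrite -ltcR; apply: le_lt_trans hm.
  rewrite (_ : _ - _ = complex.Re (l - u m)) ?normc_ge_Re //.
  by case: (l) => ? ?; case: (u m).
have /(_ _)/[dup] := ul e%:C; rewrite ltcR => /(_ e0)[n _ hn] _.
exists n => // m /hn /= hm; rewrite -ltcR; apply: le_lt_trans hm.
rewrite (_ : _ - _ = complex.Im (l - u m)) ?normc_ge_Im //.
by case: (l) => ? ?; case: (u m).
Qed.

Lemma cvg_real_complex (R : realType) (u : nat -> R) (l : R) :
  (u @ \oo --> l)%classic ->
  ((fun n => (u n)%:C : R[i]^o) @ \oo --> (l%:C : R[i]^o))%classic.
Proof.
(* The radius is a complex number here; being positive forces its imaginary part [b] to be 0. *)
move=> /cvgrPdist_lt ul; apply/cvgrPdist_lt => -[a b].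
rewrite ltcE /= => /andP[/eqP -> a0].
have [n _ hn] := ul a a0; exists n => // m /hn /= hm.
by rewrite -rmorphB normc_def /= expr0n addr0 sqrtr_sqr ltcR.
Qed.

Lemma cexpD (R : realType) (z w : R[i]) : cexp (z + w) = cexp z * cexp w.
Proof.
case: z w => [a b] [a' b']; rewrite /cexp /= expRD cosD sinD.
by apply/eqP; rewrite eq_complex /=; apply/andP; split; apply/eqP; ring.
Qed.

Lemma cexpMn (R : realType) (z : R[i]) (n : nat) : cexp (z *+ n) = cexp z ^+ n.
Proof.
elim: n => [|n IH]; last by rewrite mulrS cexpD IH exprS.
rewrite mulr0n expr0 /cexp /= expR0 cos0 sin0.
by apply/eqP; rewrite eq_complex /= !mul0r !mul1r subr0 addr0 !eqxx.
Qed.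

(** The 24th power turns the prefactor [exp (2 pi i tau / 24)] into [q]. *)
Lemma eta_expr24 (R : realType) (tau L : R[i]) :
  ((fun N => \prod_(1 <= m < N.+1) (1 - qexp tau ^+ m) : R[i]^o) @ \oo
    --> (L : R[i]^o))%classic ->
  eta tau ^+ 24 = qexp tau * L ^+ 24.
Proof.
move=> hL; rewrite /eta exprMn (cvg_lim _ hL) // -cexpMn; congr (cexp _ * _).
by rewrite -[LHS]mulr_natr divfK // pnatr_eq0.
Qed.

Lemma qexp_neg (R : realType) (x : R) : 0 < x < 1 ->
  exists2 tau : R[i], 0 < complex.Im tau & qexp tau = (- x)%:C.
Proof.
move=> x01; have /andP[x0 _] := x01.
have pi0 := pi_gt0 R; have pin0 : @pi R != 0 by rewrite lt0r_neq0.
(* Chosen so that [2 pi i tau = ln x + i pi]. *)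
exists (2^-1 +i* (- ln x / (2 * pi))).
  by rewrite /= mulr_gt0 ?invr_gt0 ?mulr_gt0 // oppr_gt0 ln_lt0.
rewrite /qexp (_ : _ * (_ +i* _) = ln x +i* pi).
  rewrite /cexp /= lnK ?posrE // cospi sinpi.
  by apply/eqP; rewrite eq_complex /=; apply/andP; split; apply/eqP; ring.
have -> : 2%:R = 2%:C :> R[i] by rewrite rmorph_nat.
apply/eqP; rewrite eq_complex /=; move: (@pi R) pin0 => p p0.
by apply/andP; split; apply/eqP; field.
Qed.

(** Doubling [tau] squares [q], so the prefactors give [-x / x^2], while [D^24] cancels. *)
Lemma eta_quotient_real (R : realType) (x : R) : 0 < x <= 3^-1 ->
  exists (tau : R[i]) (G : R), [/\ 0 < complex.Im tau,
    qexp tau = (- x)%:C,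
    ((fun N => \prod_(m < N) (1 + x ^+ m.*2.+1)) @ \oo --> G)%classic &
    eta tau ^+ 24 / eta (2%:R * tau) ^+ 24 = (- x)%:C^-1 * (G ^+ 24)%:C].
Proof.
move=> /andP[x0 x3]; have x03 : 0 <= x <= 3^-1 by rewrite ltW.
have [G [D [D0 cG cD cGD]]] := cvg_euler_split x03.
have [tau tau0 qtau] : exists2 tau : R[i], 0 < complex.Im tau & qexp tau = (- x)%:C.
  by apply: qexp_neg; rewrite x0 /=; lra.
have q2tau : qexp (2%:R * tau) = (x ^+ 2)%:C.
  have -> : (x ^+ 2)%:C = qexp tau ^+ 2 by rewrite qtau -rmorphXn /= sqrrN.
  rewrite /qexp -cexpMn; congr cexp.
  by rewrite -[RHS]mulr_natr; ring.
exists tau, G; split => //.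
have e1 : eta tau ^+ 24 = qexp tau * (G * D)%:C ^+ 24.
  apply: eta_expr24; apply: cvg_trans (cvg_real_complex cGD).
  apply: near_eq_cvg; apply: nearW => N.
  rewrite rmorph_prod; apply: eq_bigr => m _.
  by rewrite qtau rmorphB rmorph1 rmorphXn.
have e2 : eta (2%:R * tau) ^+ 24 = qexp (2%:R * tau) * D%:C ^+ 24.
  apply: eta_expr24; apply: cvg_trans (cvg_real_complex cD).
  apply: near_eq_cvg; apply: nearW => N.
  rewrite rmorph_prod; apply: eq_bigr => m _.
  by rewrite q2tau rmorphB rmorph1 !rmorphXn.
(* Rewriting with [e1] would compare the two eta values up to conversion. *)
apply: etrans (congr2 (fun a b => a / b) e1 e2) _.
rewrite qtau q2tau -!rmorphXn -!rmorphM -!fmorphV -!rmorphM /=; congr (_%:C).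
by field; rewrite ?lt0r_neq0 // ?x0.
Qed.

(** * Identification of the coefficients and their signs *)

(** [part] stands for the real or the imaginary part. The factor [-x] clears the pole, moving
    exponent [j - 1] to [j]. *)
Lemma part_q_series (R : realType) (part : R[i] -> R) (c : int -> R[i]) (x : R)
    (n : nat) : x != 0 ->
  {morph part : a b / a + b} -> (forall z r, part (z * r%:C) = part z * r) ->
  - x * part (\sum_(j < n) c (j%:Z - 1) * (- x)%:C ^ (j%:Z - 1)) =
  \sum_(j < n) part ((-1) ^+ j * c (j%:Z - 1)) * x ^+ j.
Proof.
move=> x0 partD partM.
have part0 : part 0 = 0 by rewrite -(mul0r 0%:C) partM mulr0.
have xn0 : - x != 0 by rewrite oppr_eq0.
rewrite (big_morph _ partD part0) mulr_sumr; apply: eq_bigr => j _.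
rewrite -fmorphXz partM mulrCA -[X in _ * (X * _)]expr1z -expfzDr //.
rewrite addrCA subrr addr0 -exprnP (exprNn x) mulrA.
by congr (_ * _); rewrite -partM rmorph_sign [X in part X]mulrC.
Qed.

(** The [c n] are a priori complex, so uniqueness is applied twice: to the real parts minus
    [odd_coef24], and to the imaginary parts. *)
Lemma q_expansion_coef (R : realType) (c : int -> R[i])
    (hc : has_q_expansion
            (fun tau : R[i] => eta tau ^+ 24 / eta (2%:R * tau) ^+ 24) c)
    (k : nat) :
  (-1) ^+ k * c (k%:Z - 1) = (odd_coef24 R k)%:C.
Proof.
pose e j : R[i] := (-1) ^+ j * c (j%:Z - 1).
have r0 : (0 : R) < 3^-1 by rewrite invr_gt0.
have ReD : {morph @complex.Re R : a b / a + b} by case=> ? ? [].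
have ImD : {morph @complex.Im R : a b / a + b} by case=> ? ? [].
have ReM (z : R[i]) (r : R) : complex.Re (z * r%:C) = complex.Re z * r.
  by case: z => a b /=; rewrite mulr0 subr0.
have ImM (z : R[i]) (r : R) : complex.Im (z * r%:C) = complex.Im z * r.
  by case: z => a b /=; rewrite mulr0 add0r.
have key (x : R) : 0 < x <= 3^-1 ->
    (series (fun j => (complex.Re (e j) - odd_coef24 R j) * x ^+ j) @ \oo
      --> (0 : R))%classic /\
    (series (fun j => complex.Im (e j) * x ^+ j) @ \oo --> (0 : R))%classic.
  move=> x03; have [tau [G [tau0 qtau cG etaE]]] := eta_quotient_real x03.
  have /andP[x0 _] := x03; have xn0 : x != 0 by rewrite lt0r_neq0.
  have scaled (u : nat -> R) (l : R) : (u @ \oo --> (- x)^-1 * l)%classic ->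
      ((fun n => - x * u n) @ \oo --> l)%classic.
    move=> hu; rewrite -[l](@mulVKf _ (- x)) ?oppr_eq0 //.
    by apply: cvgM hu; exact: cvg_cst.
  have /cvg_complex_parts := hc tau tau0.
  rewrite etaE qtau -fmorphV -rmorphM /= => -[/scaled hRe hIm]; split.
    have hb := odd_coef24_series (ltW x0) cG.
    rewrite (_ : series _ = fun n => - x *
        complex.Re (series (fun j => c (j%:Z - 1) * (- x)%:C ^ (j%:Z - 1)) n) -
        series (fun j => odd_coef24 R j * x ^+ j) n).
      by rewrite -(subrr (G ^+ 24)); apply: cvgB.
    apply/funext => n; rewrite !seriesEord /= part_q_series // -sumrB.
    by apply: eq_bigr => j _; rewrite mulrBl.
  (* The limit 0 is written as a multiple of [(- x)^-1] to fit [scaled]. *)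
  have /scaled {}hIm : ((fun n => complex.Im
      (series (fun j => c (j%:Z - 1) * (- x)%:C ^ (j%:Z - 1)) n)) @ \oo
      --> (- x)^-1 * 0)%classic by rewrite mulr0.
  apply: cvg_trans hIm; apply: near_eq_cvg; apply: nearW => n.
  by rewrite !seriesEord /= part_q_series.
have hRe := power_series_eq0 r0 (fun x hx => (key x hx).1) k.
have hIm := power_series_eq0 r0 (fun x hx => (key x hx).2) k.
apply/eqP; rewrite eq_complex; apply/andP; split; apply/eqP; last exact: hIm.
by apply/eqP; rewrite -subr_eq0; apply/eqP.
Qed.

Theorem theorem1 (R : realType) (c : int -> R[i])
    (hc : has_q_expansion
            (fun tau : R[i] => eta tau ^+ 24 / eta (2%:R * tau) ^+ 24) c)
    (n : int) (hn : -1 <= n) :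
  0 < (-1) ^ (n + 1) * c n /\
  (if odd `|n|%N then 0 < c n else c n < 0).
Proof.
have [k nk] : exists k : nat, n = k%:Z - 1 by exists (absz (n + 1)); lia.
have bk0 : 0 < (-1) ^+ k * c n.
  by rewrite nk (q_expansion_coef hc) ltcR odd_coef24_gt0.
split; first by rewrite nk subrK -nk -exprnP.
(* The case [k = 0] is apart: there [n = -1], whose absolute value 1 is odd. *)
rewrite (_ : odd `|n|%N = ~~ odd k); last by rewrite nk; case: (k) => [|j] //; lia.
by move: bk0; rewrite -signr_odd; case: (odd k); rewrite /= ?mul1r // mulN1r oppr_gt0.
Qed.
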